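(* Let $G=\Gamma(S)$ be the zero-divisor graph of a zero-divisor semigroup $S$ and assume that $G$ has a cycle. For a vertex $x$ of $G$ which is not an end vertex, let $T_x$ be the set of end vertices of $G$ adjacent to $x$. If $x^2\neq 0$, then $T_x\cup\{0\}$ is a sub-semigroup of $S$.
   Context: All semigroups are commutative, written multiplicatively, and have a zero element $0$ with $0x=0$ for all $x$. A zero-divisor semigroup is such a semigroup $S$ in which every element is a zero-divisor (an element $x$ with $xy=0$ for some nonzero $y\in S$). The zero-divisor graph $\Gamma(S)$ is the undirected simple graph whose vertices are the nonzero zero-divisors of $S$ (here: all of $S\setminus\{0\}$), with distinct vertices $x,y$ adjacent if and only if $xy=0$. An end vertex is a vertex of degree one. *)

(* Defs.v *)
From mathcomp Require Import all_boot.
From mathcomp Require Import boolp classical_sets functions cardinality.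

Set Implicit Arguments.
Unset Strict Implicit.
Unset Printing Implicit Defensive.

Local Open Scope classical_set_scope.
Local Open Scope card_scope.
Local Open Scope group_scope.

Section Graph.
Variables (V : eqType) (e : rel V).

Definition neighbours (x : V) : set V := [set y | e x y].

(* Degree one, as a cardinality statement since V may be infinite. *)
Definition end_vertex (x : V) : Prop := neighbours x #= `I_1.

(* A graph cycle has at least three, pairwise distinct, vertices; [ucycle]
   alone also accepts the empty sequence and a single edge traversed twice. *)
Definition has_graph_cycle : Prop :=
  exists2 c : seq V, ucycle e c & (2 < size c)%N.

Definition end_neighbours (x : V) : set V :=
  neighbours x `&` [set y | end_vertex y].

End Graph.

Definition subsemigroup (S : semigroupType) (A : set S) : Prop :=
  A !=set0 /\ mulg_closed [in A].

Section ZeroDivisorGraph.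
(* The element o plays the role of the zero of S. *)
Variables (S : semigroupType) (o : S).

Definition is_zero : Prop := forall x : S, o * x = o /\ x * o = o.

Definition zero_divisors : set S := [set x | exists2 y, y != o & x * y = o].

Definition zero_divisor_semigroup : Prop :=
  [/\ forall x y : S, x * y = y * x, is_zero & zero_divisors = [set: S]].

Definition zd_vertex : choiceType := set_type (zero_divisors `\` [set o]).

Definition zd_val (x : zd_vertex) : S := val x.

Definition zero_divisor_graph : rel zd_vertex :=
  fun x y => (x != y) && (zd_val x * zd_val y == o).

End ZeroDivisorGraph.

Arguments zero_divisor_graph {S} o.

(* Main.v *)
Require Import Defs.
From mathcomp Require Import all_boot.
From mathcomp Require Import boolp classical_sets functions cardinality.

(** Why the statement holds.  If [a] is an end vertex adjacent to [x], then an
    element killing [a] has hardly any freedom: it is [o], [x] or [a] itself.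
    Given two such [a], [b] with [a * b <> o], the product is killed by [x],
    and it differs from [x] because otherwise [x * x = a * (b * x) = o].  So
    only one thing is to be seen: any [y] with [a * b * y = o] is [o], [x] or
    [a * b].

    Since [a] kills [b * y], the latter is [o], [x] or [a]; the value [x] is
    impossible, as [b] kills [x] but [x * x <> o].  Likewise [a * y] is [o] or
    [b].
    - If [b * y = o], then [y] is [o], [x] or [b].  In the last case
      [b * b = o], hence [b] kills [a * b], which forces [a * b = b = y].
    - The case [a * y = o] is symmetric.
    - If [b * y = a] and [a * y = b], multiplying [a * b * y = o] out in two
      ways gives [a * a = o] and [b * b = o], so that [a * b = a] and
      [a * b = b] by the remark above; then [a * b = a * a = o], excluded.

    This is [annihilator_mul_end].  The description of end neighbours by
    annihilators is [end_neighboursP]; the zero element joined to the set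
    collects all products that vanish. *)

Local Open Scope classical_set_scope.
Local Open Scope group_scope.

Lemma end_vertex_neighboursE {V : eqType} {e : rel V} {x y : V} :
  e x y -> end_vertex e x -> neighbours e x = [set y].
Proof.
move=> exy /card_set_bijP[f [fI finj _]]; apply/seteqP; split=> [z exz|z ->] //.
have f0 w : neighbours e x w -> f w = 0%N.
  by move=> exw; have := fI w exw; rewrite /= ltnS leqn0 => /eqP.
by apply: finj; rewrite ?in_setE // !f0.
Qed.

Section Annihilators.
Context {S : semigroupType} {o : S}.
Hypothesis hS : zero_divisor_semigroup o.

Let mulC : forall a b : S, a * b = b * a. Proof. by case: hS. Qed.
Let mulo : forall a : S, a * o = o.
Proof. by case: hS => _ h _ a; case: (h a). Qed.

(** An end vertex may or may not square to [o], which is why [a] is among the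
    elements allowed to annihilate it. *)
Definition end_annihilator (x a : S) : Prop :=
  forall z, a * z = o -> [\/ z = o, z = x | z = a].

Lemma zd_valP (v : zd_vertex o) : zd_val v <> o.
Proof. by have := valP v; rewrite in_setE => -[]. Qed.

Lemma zd_val_onto {a : S} : a <> o -> exists v : zd_vertex o, zd_val v = a.
Proof.
move=> ao; have aP : a \in (zero_divisors o `\` [set o]).
  by rewrite in_setE; split=> //; case: hS => _ _ ->.
by exists (Sub a aP); apply: SubK.
Qed.

(** The passage from degrees to annihilators: every nonzero element is a
    vertex, so the neighbours of [a] are all the elements killing [a], up to
    [o] and [a] itself. *)
Lemma end_neighboursP {x : zd_vertex o} {a : S} :
  (@zd_val _ _ @` end_neighbours (zero_divisor_graph o) x) a <->
  [/\ a <> o, a <> zd_val x, a * zd_val x = o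
    & end_annihilator (zd_val x) a].
Proof.
split=> [[v [/andP[xv /eqP xvo] vend] <-]|[ao ax axo aann]].
  have vxo : zd_val v * zd_val x = o by rewrite mulC.
  split=> //; first exact: zd_valP.
    by move=> /val_inj vx; rewrite vx eqxx in xv.
  move=> z vzo; have [->|zo] := pselect (z = o); first by constructor 1.
  have [w wz] := zd_val_onto zo.
  have [vw|vw] := eqVneq v w; first by constructor 3; rewrite vw.
  have vw_adj : neighbours (zero_divisor_graph o) v w.
    by apply/andP; split=> //; rewrite wz vzo.
  have vx_adj : zero_divisor_graph o v x.
    by apply/andP; split; rewrite 1?eq_sym // vxo.
  move: vw_adj; rewrite (end_vertex_neighboursE vx_adj vend) => /= wx.
  by constructor 2; rewrite -wz wx.
have [v va] := zd_val_onto ao.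
have vx : v != x by apply/eqP => vx; apply: ax; rewrite -va vx.
exists v => //; split.
  by apply/andP; split; rewrite 1?eq_sym // mulC va axo.
rewrite /= /end_vertex.
suff -> : neighbours (zero_divisor_graph o) v = [set x] by exact: card_set1.
apply/seteqP; split=> [w /andP[vw /eqP]|w ->] /=; last first.
  by apply/andP; split; rewrite // va axo.
rewrite va => /aann[/zd_valP //|/val_inj //|wa].
by case/eqP: vw; apply: val_inj; rewrite -/(zd_val v) va -wa.
Qed.

Section Product.
Context {x a b : S}.
Hypotheses (x2o : x * x <> o) (bxo : b * x = o).
Hypothesis aann : end_annihilator x a.
Hypothesis abo : a * b <> o.

Lemma mul_end_neq : a * b <> x.
Proof. by move=> abx; apply: x2o; rewrite -{1}abx -mulgA bxo mulo. Qed.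

(** If [a * a = o], then [a] kills [a * b], and of the three possible values
    of [a * b] only [a] survives. *)
Lemma nilpotent_end_absorbs : a * a = o -> a * b = a.
Proof.
move=> a2o; have aabo : a * (a * b) = o by rewrite mulgA a2o mulC mulo.
by case: (aann _ aabo) => // /mul_end_neq.
Qed.

(** The value [b * y = x] is excluded because [b] kills [x], whereas
    [x * x = b * y * x] is nonzero. *)
Lemma mul_end_annihilated {y : S} : a * b * y = o -> b * y = o \/ b * y = a.
Proof.
rewrite -mulgA => /aann[|byx|]; [by left| |by right].
by case: x2o; rewrite -{1}byx -mulgA (mulC y) mulgA bxo mulC mulo.
Qed.

End Product.

Lemma annihilator_mul_end {x a b : S} :
  x * x <> o -> a * x = o -> b * x = o ->
  end_annihilator x a -> end_annihilator x b ->
  a * b <> o -> end_annihilator x (a * b).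
Proof.
move=> x2o axo bxo aann bann abo y abyo.
have bao : b * a <> o by rewrite mulC.
have bayo : b * a * y = o by rewrite (mulC b).
have absorb_a : a * a = o -> a * b = a := nilpotent_end_absorbs x2o bxo aann abo.
have absorb_b : b * b = o -> a * b = b.
  by move=> b2o; rewrite mulC (nilpotent_end_absorbs x2o axo bann bao b2o).
have [byo|bya] := mul_end_annihilated x2o bxo aann abyo.
  have [->|->|yb] := bann _ byo; [by constructor 1|by constructor 2|].
  by constructor 3; rewrite yb in byo *; rewrite absorb_b.
have [ayo|ayb] := mul_end_annihilated x2o axo bann bayo.
  have [->|->|ya] := aann _ ayo; [by constructor 1|by constructor 2|].
  by constructor 3; rewrite ya in ayo *; rewrite absorb_a.
have a2o : a * a = o by rewrite -{2}bya mulgA.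
have b2o : b * b = o by rewrite -{2}ayb mulgA.
by case: abo; rewrite -{1}(absorb_a a2o) absorb_b // b2o.
Qed.

End Annihilators.

Theorem proposition2p7 (S : semigroupType) (o : S)
    (hS : zero_divisor_semigroup o)
    (hcycle : has_graph_cycle (zero_divisor_graph o))
    (x : zd_vertex o) (hx : ~ end_vertex (zero_divisor_graph o) x)
    (hx2 : zd_val x * zd_val x <> o) :
  subsemigroup ((@zd_val _ _ @` end_neighbours (zero_divisor_graph o) x) `|` [set o]).
Proof.
have [_ zo _] := hS.
split; first by exists o; right.
move=> a b /=; rewrite !in_setE.
move=> [/(end_neighboursP hS)[_ _ axo aann]|->] [|->];
  rewrite ?(zo _).1 ?(zo _).2; try by right.
- move=> /(end_neighboursP hS)[_ _ bxo bann].
  have [abo|abo] := pselect (a * b = o); first by right.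
  left; apply/(end_neighboursP hS); split=> //.
  + exact: (mul_end_neq hS hx2 bxo).
  + by rewrite -mulgA bxo (zo a).2.
  + exact: (annihilator_mul_end hS hx2 axo bxo aann bann abo).
Qed.
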